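(* Let $X$ be a real locally convex topological vector space and let $f,g\colon X\to(-\infty,\infty]$ be proper convex functions, where $f$ is a polyhedral function. Suppose that $\mathrm{dom}(f)\cap\mathrm{qri}(\mathrm{dom}(g))\neq\emptyset$. Then $$(f+g)^*(x^* )=(f^*\,\square\,g^* )(x^* )\quad\text{for all }x^*\in X^*.$$ Moreover, the infimum in $(f^*\,\square\,g^* )(x^* )$ is attained, i.e., for any $x^*\in\mathrm{dom}((f+g)^* )$ there exist $x_1^*,x_2^*\in X^*$ for which $$(f+g)^*(x^* )=f^*(x_1^* )+g^*(x_2^* ),\qquad x^*=x_1^*+x_2^*.$$
   Context: For an extended-real-valued function $h$, $\mathrm{dom}(h)$ is the set of points where $h<\infty$; $\mathrm{epi}(f):=\{(x,\lambda)\in X\times\mathbb{R}\mid f(x)\le\lambda\}$. The Fenchel conjugate is $f^*(x^* ):=\sup\{\langle x^*,x\rangle-f(x)\mid x\in X\}$, $x^*\in X^*$. The infimal convolution of $\varphi,\psi\colon X^*\to(-\infty,\infty]$ is $(\varphi\,\square\,\psi)(x^* ):=\inf\{\varphi(x_1^* )+\psi(x_2^* )\mid x_1^*+x_2^*=x^*\}$. A subset $P$ of a locally convex space $Z$ is a convex polyhedron if $P=\{z\in Z\mid\langle z_i^*,z\rangle\le\alpha_i,\ i=1,\dots,k\}$ for finitely many $z_i^*\in Z^*$, $\alpha_i\in\mathbb{R}$; $f$ is polyhedral if $\mathrm{epi}(f)$ is a convex polyhedron in $X\times\mathbb{R}$. For a convex set $\Omega$, $\mathrm{qri}(\Omega):=\{x\in\Omega\mid\overline{\mathrm{cone}(\Omega-x)}\text{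 is a linear subspace}\}$, where $\mathrm{cone}(A):=\{ta\mid t\ge0,\ a\in A\}$. *)

(* Defs.v *)
From HB Require Import structures.
From mathcomp Require Import all_boot all_order all_algebra.
From mathcomp Require Import all_classical all_reals all_analysis.

Set Implicit Arguments.
Unset Strict Implicit.
Unset Printing Implicit Defensive.

Import Order.TTheory GRing.Theory Num.Theory.
Import numFieldNormedType.Exports.

Local Open Scope classical_set_scope.
Local Open Scope ring_scope.

(* The topological dual, carried as a submodule of the functions X -> R^o, so
   that its addition and scaling are the pointwise ones. *)
Section TopologicalDual.
Context (R : realType) (X : tvsType R).

Definition continuous_linear_form : {pred X -> R^o} :=
  [pred phi : X -> R^o | `[< linear phi /\ continuous phi >]].

Record tvs_dual := Dual {
  dual_val :> X -> R^o ;
  _ : dual_val \in continuous_linear_form }.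

Lemma continuous_linear_form_submod :
  GRing.submod_closed continuous_linear_form.
Proof.
split=> [|a u v /asboolP[lu cu] /asboolP[lv cv]]; apply/asboolP; split.
- by move=> a x y; rewrite /= addr0 scaler0.
- exact: cst_continuous.
- by move=> b x y; rewrite /= !fctE lu lv !scalerDr !scalerA (mulrC b) addrACA.
- move=> x; apply: (@cvgD _ R^o); last exact: cv.
  by apply: (@cvgZr _ R^o); exact: cu.
Qed.

HB.instance Definition _ := GRing.isSubmodClosed.Build R (X -> R^o)
  continuous_linear_form continuous_linear_form_submod.

HB.instance Definition _ := [isSub for dual_val].
HB.instance Definition _ := [Choice of tvs_dual by <:].
HB.instance Definition _ := [SubChoice_isSubLmodule of tvs_dual by <:].

Lemma dual_linear (phi : tvs_dual) : linear phi.
Proof. by case: phi => phi /= /asboolP[]. Qed.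

Lemma dual_continuous (phi : tvs_dual) : continuous phi.
Proof. by case: phi => phi /= /asboolP[]. Qed.

HB.instance Definition _ (phi : tvs_dual) :=
  GRing.isLinear.Build R X R^o *:%R (dual_val phi) (@dual_linear phi).

End TopologicalDual.

Section ExtendedRealFunctions.
Context (R : realType).
Local Open Scope ereal_scope.

Definition edom (T : Type) (h : T -> \bar R) : set T := [set x | h x < +oo].

(* The requirement that h takes its values in (-oo, +oo] is included here. *)
Definition proper_efun (T : Type) (h : T -> \bar R) : Prop :=
  (forall x, -oo < h x) /\ edom h !=set0.

Definition convex_efun (X : lmodType R) (h : X -> \bar R) : Prop :=
  forall (x y : X) (t : R), (0 < t < 1)%R ->
    h (t *: x + (1 - t) *: y)%R <= t%:E * h x + (1 - t)%:E * h y.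

Definition epi (X : lmodType R) (h : X -> \bar R) : set (X * R^o) :=
  [set z | h z.1 <= z.2%:E].

Definition fenchel_conj (X : tvsType R) (h : X -> \bar R) :
    tvs_dual X -> \bar R :=
  fun xs => ereal_sup [set (xs x)%:E - h x | x in [set: X]].

(* Meant for functions that do not take the value -oo, so that the sums below
   never involve -oo + +oo. *)
Definition infimal_convolution (V : zmodType) (phi psi : V -> \bar R) :
    V -> \bar R :=
  fun v => ereal_inf [set phi p.1 + psi p.2 | p in [set p : V * V | p.1 + p.2 = v]%R].

End ExtendedRealFunctions.

Definition convex_polyhedron (R : realType) (Z : tvsType R) (P : set Z) : Prop :=
  exists (k : nat) (zs : 'I_k -> tvs_dual Z) (alpha : 'I_k -> R),
    P = [set z | forall i, zs i z <= alpha i].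

Definition polyhedral (R : realType) (X : tvsType R) (h : X -> \bar R) : Prop :=
  convex_polyhedron (epi h).

Definition cone_of (R : realType) (X : lmodType R) (A : set X) : set X :=
  [set t *: a | t in [set t : R | 0 <= t] & a in A].

Definition qri (R : realType) (X : tvsType R) (Omega : set X) : set X :=
  [set x | Omega x /\
    GRing.submod_closed [in closure (cone_of [set w - x | w in Omega])]].

(* Main.v *)
Require Import Defs.
From HB Require Import structures.
From mathcomp Require Import all_boot all_order all_algebra.
From mathcomp Require Import all_classical all_reals all_analysis.
From mathcomp Require Import ring lra.

Set Implicit Arguments.
Unset Strict Implicit.
Unset Printing Implicit Defensive.

Import Order.TTheory GRing.Theory Num.Theory.
Import numFieldNormedType.Exports.

Local Open Scope classical_set_scope.

(** The theorem is a strong duality statement.  The inequality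
    [conj (f + g) <= conj f [] conj g], where [[]] is infimal convolution, is
    that of Fenchel and Young.  For the converse, with attainment, let [M] be a
    real bound of [conj (f + g)] at [xs].  Then
    [F(x, l) := g(x) - xs(x) + l + M] is nonnegative on
    [(dom g x R) /\ epi f], and [epi f] is cut out by finitely many affine
    inequalities.  If an affine function [psi - p] on [X x R] is nonpositive on
    [epi f] and satisfies [F + psi - p >= 0] on all of [dom g x R], then letting
    [l] go to both infinities gives [psi(0, 1) = -1], and [x1s := psi(., 0)]
    satisfies [conj f x1s <= p] and [conj g (xs - x1s) <= M - p].

    The existence of [psi - p] ([polyhedral_separation]) is a matter of the
    dual alone. What a point [x0] of [qri (dom g)] provides is that a
    continuous functional that attains its minimum over [dom g] at [x0] is
    constant on [dom g] ([qri_nonsupport]): such a functional is nonnegative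
    on the closed cone spanned by [dom g - x0], which is a linear subspace.
    This property passes to [dom g x R].

    The proof of [polyhedral_separation] is an induction on the number of
    inequalities which treats them one at a time. A single affine constraint
    [q <= a] or [q = a] is removed by a Lagrange multiplier, which exists by
    an argument about suprema of real numbers, provided that [C] has a point
    with [q < a], respectively points on both sides of [q = a]. Intersecting
    [C] with a half-space [q <= a] that is active at the base point destroys
    its nonsupport property unless [q] is constant on [C], since [- q] becomes
    minimal there. Hence two cases. If some feasible point satisfies [q < a],
    moving the base point halfway towards it makes the constraint inactive,
    and [C] can be cut by the half-space. If not, the other constraints force
    [q >= a]; then cutting [C] by the hyperplane [q = a] gives a multiplier of
    unknown sign, and the induction hypothesis applied to the objective [q -
    a] yields what is needed to correct a negative sign. *)

(** * One affine constraint *)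

Section OneConstraint.
Context (R : realType) (E : lmodType R).
Local Open Scope ring_scope.

(** The convexity of [C] is part of the notion because the arguments below cut
    [C] down while they keep [F]. *)
Definition convex_on (C : set E) (F : E -> R) : Prop :=
  forall (x y : E) (t : R), C x -> C y -> 0 < t < 1 ->
    C (t *: x + (1 - t) *: y) /\
    F (t *: x + (1 - t) *: y) <= t * F x + (1 - t) * F y.

Lemma linear_on_segment (q : {linear E -> R^o}) (x y : E) (t : R) :
  q (t *: x + (1 - t) *: y) = t * q x + (1 - t) * q y.
Proof. by rewrite linearD !linearZ. Qed.

Lemma convex_on_affine (C : set E) (F : E -> R) (q : {linear E -> R^o})
    (a : R) :
  convex_on C F -> convex_on C (fun z => q z - a).
Proof.
move=> cF x y t Cx Cy t01; split; first by have [] := cF x y t Cx Cy t01.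
by rewrite linear_on_segment; lra.
Qed.

Lemma convex_on_add_affine (C : set E) (F : E -> R) (q : {linear E -> R^o})
    (a : R) :
  convex_on C F -> convex_on C (fun z => F z + (q z - a)).
Proof.
move=> cF x y t Cx Cy t01; have [Cz Fz] := cF x y t Cx Cy t01; split=> //.
rewrite linear_on_segment; move: Fz => /=; lra.
Qed.

Lemma convex_on_halfspace (C : set E) (F : E -> R) (q : {linear E -> R^o})
    (a : R) :
  convex_on C F -> convex_on (C `&` [set z | q z <= a]) F.
Proof.
move=> cF x y t [Cx /= qx] [Cy /= qy] t01; have [Cz Fz] := cF x y t Cx Cy t01.
split=> //; split=> //=; rewrite linear_on_segment; move: t01 => /andP[t0 t1].
nra.
Qed.

Lemma convex_on_hyperplane (C : set E) (F : E -> R) (q : {linear E -> R^o})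
    (a : R) :
  convex_on C F -> convex_on (C `&` [set z | q z = a]) F.
Proof.
move=> cF x y t [Cx /= qx] [Cy /= qy] t01; have [Cz Fz] := cF x y t Cx Cy t01.
by split=> //; split=> //=; rewrite linear_on_segment qx qy; ring.
Qed.

(** Convexity, on a segment that crosses the hyperplane from [x] to [y], says
    that [- F y / (q y - a) <= F x / (a - q x)].  The multiplier must lie
    between all the left-hand sides and all the right-hand sides; the supremum
    of the former does. *)
Lemma equality_multiplier (C : set E) (F : E -> R) (q : {linear E -> R^o})
    (a : R) (zl zr : E) :
  convex_on C F -> C zl -> q zl < a -> C zr -> a < q zr ->
  (forall z, C z -> q z = a -> 0 <= F z) ->
  exists w : R, forall z, C z -> 0 <= F z + w * (q z - a).
Proof.
move=> cF Czl qzl Czr qzr F0.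
have cross x y : C x -> q x < a -> C y -> a < q y ->
    - F y / (q y - a) <= F x / (a - q x).
  move=> Cx qx Cy qy.
  have d0 : 0 < q y - q x by lra.
  (* With this weight, the point of the segment lies on the hyperplane. *)
  pose t := (q y - a) / (q y - q x).
  have t01 : 0 < t < 1.
    apply/andP; split; first by apply: divr_gt0; lra.
    by rewrite ltr_pdivrMr//; lra.
  have [Cz Fz] := cF x y t Cx Cy t01.
  have /(F0 _ Cz) Fz0 : q (t *: x + (1 - t) *: y) = a.
    by rewrite linear_on_segment /t; field; lra.
  rewrite ler_pdivrMr ?subr_gt0// [leRHS]mulrAC ler_pdivlMr ?subr_gt0//.
  have := le_trans Fz0 Fz; rewrite -(pmulr_rge0 _ d0).
  have -> : (q y - q x) * (t * F x + (1 - t) * F y) =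
      (q y - a) * F x + (a - q x) * F y by rewrite /t; field; lra.
  by move=> ?; lra.
pose S := [set - F z / (q z - a) | z in C `&` [set z | a < q z]].
have Sub z : C z -> q z < a -> ubound S (F z / (a - q z)).
  by move=> Cz qz _ [y [Cy qy] <-]; exact: cross.
have S0 : S !=set0 by exists (- F zr / (q zr - a)), zr.
exists (sup S) => z Cz; have [qz|qz|qz] := ltgtP (q z) a.
- have := ge_sup S0 (Sub z Cz qz).
  by rewrite ler_pdivlMr ?subr_gt0// => ?; lra.
- have : - F z / (q z - a) <= sup S.
    apply: sup_upper_bound; last by exists z.
    by split=> //; exists (F zl / (a - q zl)); exact: Sub.
  by rewrite ler_pdivrMr ?subr_gt0// => ?; lra.
- by rewrite qz subrr mulr0 addr0; exact: F0.
Qed.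

(** A negative multiplier [w] can be replaced by 0: it shows that [0 <= F] where
    [a < q], and elsewhere this is assumed. *)
Lemma slater_multiplier (C : set E) (F : E -> R) (q : {linear E -> R^o})
    (a : R) (zl : E) :
  convex_on C F -> C zl -> q zl < a ->
  (forall z, C z -> q z <= a -> 0 <= F z) ->
  exists2 w : R, 0 <= w & forall z, C z -> 0 <= F z + w * (q z - a).
Proof.
move=> cF Czl qzl F0.
have [[zr [Czr qzr]]|Nzr] := pselect (exists z, C z /\ a < q z); last first.
  exists 0 => // z Cz; rewrite mul0r addr0; apply: F0 => //.
  by rewrite leNgt; apply/negP => qz; apply: Nzr; exists z.
have [z Cz qz|w Fw] := equality_multiplier cF Czl qzl Czr qzr.
  by apply: F0; rewrite ?qz.
exists (Num.max w 0) => [|z Cz]; first by rewrite le_max lexx orbT.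
have := Fw z Cz; have [w0|w0] := leP w 0 => //.
have [/(F0 z Cz) qz _|qz] := leP (q z) a; first by rewrite mul0r addr0.
by move=> ?; nra.
Qed.

End OneConstraint.

(** * Nonsupport points *)

Section DualOps.
Context (R : realType) (X : tvsType R).
Local Open Scope ring_scope.

Lemma dualD (phi psi : tvs_dual X) x : (phi + psi) x = phi x + psi x.
Proof. by []. Qed.

Lemma dualN (phi : tvs_dual X) x : (- phi) x = - phi x.
Proof. by []. Qed.

Lemma dualZ (phi : tvs_dual X) (a : R) x : (a *: phi) x = a * phi x.
Proof. by []. Qed.

End DualOps.

Section NonsupportPoints.
Context (R : realType) (Z : tvsType R).
Local Open Scope ring_scope.

(** For convex [C], a dual description of the quasi-relative interior points
    among the points of [C]. *)
Definition nonsupport_point (C : set Z) (z0 : Z) : Prop :=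
  forall phi : tvs_dual Z, (forall z, C z -> phi z0 <= phi z) ->
    forall z, C z -> phi z = phi z0.

(** A functional that is minimal at [x] is nonnegative on the closed cone
    spanned by [C - x].  As this cone is a linear subspace, the functional
    vanishes on it. *)
Lemma qri_nonsupport (C : set Z) (x : Z) : qri C x -> nonsupport_point C x.
Proof.
move=> [Cx [L0 Lsub]] phi phix z Cz.
set L := closure _ in L0 Lsub.
have Lphi v : L v -> 0 <= phi v.
  move=> Lv; apply: (@preimage_closed _ _ phi [set r : R^o | 0 <= r]).
  - by move=> y _; exact: dual_continuous.
  - exact: closed_ge.
  - apply: closureS Lv => _ [t /= t0 [_ [w Cw <-] <-]].
    rewrite /= linearZ linearB /=; apply: mulr_ge0 => //.
    by rewrite subr_ge0; exact: phix.
have Lzx : L (z - x).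
  apply: subset_closure; exists 1 => //=.
  by exists (z - x); rewrite ?scale1r//; exists z.
have LNzx : L (- (z - x)).
  have := Lsub (-1) (z - x) 0; rewrite !inE addr0 scaleN1r; apply => //.
  by move: L0; rewrite inE.
have := Lphi _ LNzx; have := Lphi _ Lzx.
by rewrite linearN linearB /= => ? ?; lra.
Qed.

(** A functional minimal at a point strictly between [z0] and [z1] is constant
    on that segment, hence also minimal at the end [z0]. *)
Lemma nonsupport_segment (C : set Z) (z0 z1 : Z) (t : R) :
  C z0 -> C z1 -> 0 < t < 1 -> nonsupport_point C z0 ->
  nonsupport_point C (t *: z0 + (1 - t) *: z1).
Proof.
move=> Cz0 Cz1 /andP[t0 t1] ns phi.
rewrite linear_on_segment => ge.
have := ge _ Cz0; have := ge _ Cz1 => h1 h0.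
have e : phi z1 = phi z0 by nra.
have e' : t * phi z0 + (1 - t) * phi z1 = phi z0 by rewrite e; ring.
by rewrite e' in ge *; exact: ns.
Qed.

(** Near [z0] the half-space does not restrict [C], and minimality of a
    functional over a convex set is a local matter. *)
Lemma nonsupport_halfspace (C : set Z) (F : Z -> R) (q : {linear Z -> R^o})
    (a : R) (z0 : Z) :
  convex_on C F -> C z0 -> q z0 < a -> nonsupport_point C z0 ->
  nonsupport_point (C `&` [set z | q z <= a]) z0.
Proof.
move=> cF Cz0 qz0 ns phi ge z [Cz _]; apply: ns => // {Cz}z Cz.
have [qz|qz] := leP (q z) a; first exact: ge.
(* The segment from [z0] to [z] leaves the half-space at this weight of [z]. *)
pose t := (a - q z0) / (q z - q z0).
have d0 : 0 < q z - q z0 by lra.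
have t01 : 0 < t < 1.
  apply/andP; split; first by apply: divr_gt0; lra.
  by rewrite ltr_pdivrMr//; lra.
have [Cy _] := cF z z0 t Cz Cz0 t01.
have /ge : (C `&` [set z | q z <= a]) (t *: z + (1 - t) *: z0).
  split=> //=; rewrite linear_on_segment.
  by rewrite le_eqVlt; apply/orP; left; apply/eqP; rewrite /t; field; lra.
by rewrite linear_on_segment; move: t01 => /andP[? ?] ?; nra.
Qed.

(** Supplies the two points that [equality_multiplier] asks for. *)
Lemma nonsupport_two_sides (C : set Z) (q : tvs_dual Z) (z0 : Z) :
  nonsupport_point C z0 ->
  (forall z, C z -> q z = q z0) \/
  (exists zl zr, [/\ C zl, q zl < q z0, C zr & q z0 < q zr]).
Proof.
move=> ns.
have [[zl [Czl qzl]]|Nl] := pselect (exists z, C z /\ q z < q z0); last first.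
  left; apply: ns => z Cz; rewrite leNgt; apply/negP => qz.
  by apply: Nl; exists z.
have [[zr [Czr qzr]]|Nr] := pselect (exists z, C z /\ q z0 < q z).
  by right; exists zl, zr.
left=> z Cz; apply: oppr_inj; apply: (ns (- q)) Cz => y Cy.
rewrite !dualN lerN2 leNgt; apply/negP => qy.
by apply: Nr; exists y.
Qed.

(** If [phi] is minimal at [z0] over the hyperplane section, a multiplier [w]
    makes [phi + w *: q] minimal at [z0] over all of [C]; it is then constant on
    [C], and so is [phi] where [q] is. *)
Lemma nonsupport_hyperplane (C : set Z) (F : Z -> R) (q : tvs_dual Z)
    (z0 : Z) :
  convex_on C F -> C z0 -> nonsupport_point C z0 ->
  nonsupport_point (C `&` [set z | q z = q z0]) z0.
Proof.
move=> cF Cz0 ns phi ge z [Cz /= qz].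
have [cst|[zl [zr [Czl qzl Czr qzr]]]] := nonsupport_two_sides q ns.
  by apply: ns => // y Cy; apply: ge; split=> //; exact: cst.
have cphi : convex_on C (fun y => phi y - phi z0).
  exact: convex_on_affine cF.
have [y Cy qy|w hw] := equality_multiplier cphi Czl qzl Czr qzr.
  by rewrite subr_ge0; apply: ge.
have : (phi + w *: q) z = (phi + w *: q) z0.
  by apply: ns Cz => y Cy; have := hw y Cy; rewrite !dualD !dualZ => ?; lra.
by rewrite !dualD !dualZ qz => /addIr.
Qed.

End NonsupportPoints.

(** * Separation of a polyhedron from a convex set *)

Section PolyhedralSeparation.
Context (R : realType) (Z : tvsType R).
Local Open Scope ring_scope.

Lemma forall_ord_recl (k : nat) (P : 'I_k.+1 -> Prop) :
  (forall i, P i) <-> P ord0 /\ forall i, P (lift ord0 i).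
Proof.
split=> [h|[h0 h] i]; first by split.
by case: (unliftP ord0 i) => [j|] ->.
Qed.

(** A Farkas lemma for a convex objective over [C]: as [psi - p] one may think
    of the combination of the [q i - a i] with nonnegative multipliers.  Only
    its sign on the polyhedron matters, and keeping the multipliers out of the
    statement keeps sums out of the induction. *)
Theorem polyhedral_separation (k : nat) (q : 'I_k -> tvs_dual Z)
    (a : 'I_k -> R) (C : set Z) (F : Z -> R) (z0 : Z) :
  convex_on C F -> C z0 -> (forall i, q i z0 <= a i) -> nonsupport_point C z0 ->
  (forall z, C z -> (forall i, q i z <= a i) -> 0 <= F z) ->
  exists (psi : tvs_dual Z) (p : R),
    (forall z, (forall i, q i z <= a i) -> psi z <= p) /\
    (forall z, C z -> 0 <= F z + (psi z - p)).
Proof.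
elim: k q a C F z0 => [|k IHk] q a C F z0 cF Cz0 Pz0 ns F0.
  exists 0, 0; split=> [z _|z Cz]; first exact: lexx.
  have -> : (0 : tvs_dual Z) z = 0 by [].
  by rewrite subr0 addr0; apply: F0 => // -[].
pose q1 := q ord0; pose a1 := a ord0.
pose q' i := q (lift ord0 i); pose a' i := a (lift ord0 i).
pose P' z := forall i, q' i z <= a' i.
have splitP z : (forall i, q i z <= a i) <-> q1 z <= a1 /\ P' z.
  exact: forall_ord_recl.
have [q1z0 P'z0] := (splitP z0).1 Pz0.
have [[z1 [Cz1 P'z1 q1z1]]|Nz1] :=
    pselect (exists z, [/\ C z, P' z & q1 z < a1]).
- (* A feasible point satisfies the first inequality strictly.  The midpoint
     [zm] is still a nonsupport point, and there the inequality is inactive. *)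
  pose t : R := 2^-1; have t01 : 0 < t < 1 by rewrite /t; lra.
  pose zm := t *: z0 + (1 - t) *: z1.
  have Czm : C zm by have [] := cF z0 z1 t Cz0 Cz1 t01.
  have q1zm : q1 zm < a1 by rewrite /zm linear_on_segment /t; lra.
  have P'zm : P' zm.
    move=> i; rewrite /zm linear_on_segment.
    have := P'z0 i; have := P'z1 i; rewrite /t => ? ?; lra.
  have nsm : nonsupport_point (C `&` [set z | q1 z <= a1]) zm.
    apply: nonsupport_halfspace cF Czm q1zm _.
    exact: nonsupport_segment.
  have [|z [Cz q1z] P'z|psi [p [psip Fpsi]]] :=
      IHk q' a' _ F zm (convex_on_halfspace (q := q1) (a := a1) cF) _ P'zm nsm.
  + by split=> //=; apply: ltW.
  + by apply: F0 => //; apply/splitP.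
  have [z Cz q1z|w w0 hw] :=
      slater_multiplier (convex_on_add_affine psi p cF) Czm q1zm.
    exact: Fpsi.
  exists (psi + w *: q1), (p + w * a1); split=> [z /splitP[q1z P'z]|z Cz].
    by rewrite dualD dualZ; apply: lerD; [exact: psip|exact: ler_wpM2l].
  by have := hw z Cz; rewrite dualD dualZ => ?; lra.
(* From here on the other inequalities imply [a1 <= q1] on [C]: the first one
   acts as an equality. *)
have q1ge z : C z -> P' z -> a1 <= q1 z.
  by move=> Cz P'z; rewrite leNgt; apply/negP => q1z; apply: Nz1; exists z.
have q1z0E : q1 z0 = a1 by apply/eqP; rewrite eq_le q1z0 q1ge.
(* [u - r] certifies that implication; adding a multiple of [q1 - a1 + (u - r)],
   which is nonnegative on [C], raises the coefficient of [q1 - a1]. *)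
have [z Cz P'z|u [r [ur hu]]] :=
    IHk q' a' C _ z0 (convex_on_affine q1 a1 cF) Cz0 P'z0 ns.
  by rewrite subr_ge0; exact: q1ge.
have [|z [Cz q1z] P'z|psi [p [psip Fpsi]]] :=
    IHk q' a' _ F z0 (convex_on_hyperplane (q := q1) (a := q1 z0) cF) _ P'z0
        (nonsupport_hyperplane (q := q1) cF Cz0 ns).
- by [].
- by apply: F0 => //; apply/splitP; split=> //; rewrite q1z q1z0E.
have [w hw] : exists w : R,
    forall z, C z -> 0 <= F z + (psi z - p) + w * (q1 z - a1).
  have [cst|[zl [zr [Czl qzl Czr qzr]]]] := nonsupport_two_sides q1 ns.
    exists 0 => z Cz; rewrite mul0r addr0; apply: Fpsi; split=> //.
    exact: cst.
  rewrite -q1z0E.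
  apply: (equality_multiplier (convex_on_add_affine psi p cF) Czl qzl Czr qzr).
  by move=> z Cz q1z; apply: Fpsi.
have [w0|w0] := leP 0 w.
  exists (psi + w *: q1), (p + w * a1); split=> [z /splitP[q1z P'z]|z Cz].
    by rewrite dualD dualZ; apply: lerD; [exact: psip|exact: ler_wpM2l].
  by have := hw z Cz; rewrite dualD dualZ => ?; lra.
(* Raised by [- w], the coefficient [w] of [q1 - a1] becomes 0. *)
exists (psi + (- w) *: u), (p + (- w) * r); split=> [z /splitP[q1z P'z]|z Cz].
  rewrite dualD dualZ; apply: lerD; first exact: psip.
  by apply: ler_wpM2l; [rewrite oppr_ge0 ltW|exact: ur].
have := hw z Cz; have := hu z Cz; rewrite dualD dualZ => hz ?; nra.
Qed.

End PolyhedralSeparation.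

(** * Functionals and convex sets in [X * R] *)

Section DualOfProduct.
Context (R : realType) (X : tvsType R).
Local Open Scope ring_scope.

Lemma dual_fst_subproof (psi : tvs_dual (X * R^o)%type) :
  (fun x : X => psi (x, 0)) \in @continuous_linear_form R X.
Proof.
apply/asboolP; split=> [a x y|x].
  rewrite -[RHS](dual_linear psi a (x, 0) (y, 0)); congr (psi _).
  by congr pair; rewrite /= scaler0 addr0.
apply: (@cvg_comp _ _ _ (fun y : X => (y, 0 : R^o)) psi _ (nbhs (x, 0 : R^o))).
  apply: (@cvg_pair _ _ _ _ (nbhs x) (nbhs (0 : R^o))).
    exact: cvg_id.
  exact: cvg_cst.
exact: dual_continuous.
Qed.

Definition dual_fst (psi : tvs_dual (X * R^o)%type) : tvs_dual X :=
  Dual (dual_fst_subproof psi).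

Lemma dual_prodE (psi : tvs_dual (X * R^o)%type) (x : X) (l : R) :
  psi (x, l) = dual_fst psi x + l * psi (0, 1).
Proof.
rewrite -[l * _]/(l *: psi (0, 1)) -[dual_fst _ _]/(psi (x, 0)).
rewrite -linearZ -linearD; congr (psi _); congr pair.
  by rewrite /= scaler0 addr0.
by rewrite /= add0r /GRing.scale /= mulr1.
Qed.

Lemma bounded_below_line (c b e : R) : (forall l : R, c <= b + l * e) -> e = 0.
Proof.
move=> ge; apply/eqP/negPn/negP => e0.
have := ge ((c - b - 1) / e).
by rewrite divfK// => ?; lra.
Qed.

(** A functional bounded below on a vertical line does not depend on the last
    coordinate. *)
Lemma nonsupport_point_cylinder (C : set X) (x0 : X) (l0 : R) :
  C x0 -> nonsupport_point C x0 ->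
  nonsupport_point [set z : (X * R^o)%type | C z.1] (x0, l0 : R^o).
Proof.
move=> Cx0 ns psi ge.
have psi01 : psi (0, 1) = 0.
  apply: (@bounded_below_line (psi (x0, l0)) (dual_fst psi x0)) => l.
  by rewrite -dual_prodE; exact: ge.
have psiE x l : psi (x, l) = dual_fst psi x.
  by rewrite dual_prodE psi01 mulr0 addr0.
move=> [x l] /= Cx; rewrite !psiE; apply: ns Cx => y Cy.
by rewrite -(psiE _ l0) -(psiE y 0); exact: ge.
Qed.

End DualOfProduct.

(** * Fenchel duality *)

Section FenchelDuality.
Context (R : realType) (X : tvsType R).
Local Open Scope ereal_scope.

Lemma fenchel_young (h : X -> \bar R) (xs : tvs_dual X) (x : X) :
  (xs x)%:E - h x <= fenchel_conj h xs.
Proof. by apply: ereal_sup_ubound; exists x. Qed.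

Lemma fenchel_conj_le (h : X -> \bar R) (xs : tvs_dual X) (p : R) :
  (forall x (l : R), h x <= l%:E -> (xs x - l <= p)%R) ->
  (forall x, -oo < h x) ->
  fenchel_conj h xs <= p%:E.
Proof.
move=> le hNy; apply: ge_ereal_sup => _ [x _ <-].
have := hNy x; case hx : (h x) => [l| |] // _.
  by rewrite -EFinB lee_fin; apply: le; rewrite hx.
by rewrite leNye.
Qed.

Lemma fenchel_conj_add_le (f g : X -> \bar R) (x1s x2s : tvs_dual X) :
  (forall x, -oo < f x) -> (forall x, -oo < g x) ->
  fenchel_conj (f \+ g) (x1s + x2s)%R <=
    fenchel_conj f x1s + fenchel_conj g x2s.
Proof.
move=> fNy gNy; apply: ge_ereal_sup => _ [x _ <-].
rewrite -[(f \+ g) x]/(f x + g x).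
have := fenchel_young f x1s x; have := fenchel_young g x2s x.
have := fNy x; have := gNy x.
case: (f x) => [l| |] //; case: (g x) => [m| |] // _ _ hg hf;
  rewrite ?addye ?addey ?leNye//.
apply: le_trans (leeD hf hg); rewrite lee_fin.
have -> : ((x1s + x2s)%R x = x1s x + x2s x :> R)%R by [].
by lra.
Qed.

Lemma convex_on_efun (g : X -> \bar R) :
  (forall x, -oo < g x) -> convex_efun g ->
  convex_on (edom g) (fine \o g).
Proof.
move=> gNy cg x y t gx gy t01.
have fin z : edom g z -> g z \is a fin_num.
  by rewrite /edom /= => gz; rewrite fin_numElt gNy.
have := cg x y t t01; rewrite -(fineK (fin x gx)) -(fineK (fin y gy)) => le.
have gt : edom g (t *: x + (1 - t) *: y)%R.
  by rewrite /edom /=; apply: le_lt_trans le _; rewrite -!EFinM -EFinD ltry.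
by split=> //; move: le; rewrite -(fineK (fin _ gt)) -!EFinM -EFinD lee_fin.
Qed.

(** [polyhedral_separation] with the polyhedron [epi f] and the convex set
    [dom g x R].  The last coordinate of a point is a value above [f], so the
    objective [F] is at least [f + g - xs + M] on the intersection. *)
Lemma fenchel_conj_add_attained (f g : X -> \bar R) (xs : tvs_dual X) (M : R) :
  proper_efun f -> proper_efun g -> convex_efun g -> polyhedral f ->
  edom f `&` qri (edom g) !=set0 ->
  fenchel_conj (f \+ g) xs <= M%:E ->
  exists x1s x2s : tvs_dual X,
    fenchel_conj f x1s + fenchel_conj g x2s <= M%:E /\ xs = (x1s + x2s)%R.
Proof.
move=> [fNy _] [gNy _] cg [k [q [a epiE]]] [x0 [fx0 qx0]] leM.
have gx0 : edom g x0 by case: qx0.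
pose C : set (X * R^o)%type := [set z | edom g z.1].
pose F (z : X * R^o) : R := (fine (g z.1) - xs z.1 + z.2 + M)%R.
have epiP z : epi f z <-> (forall i, (q i z <= a i)%R).
  by rewrite epiE.
have finP (h : X -> \bar R) x : (forall x, -oo < h x) -> edom h x ->
    h x = (fine (h x))%:E.
  by move=> hNy hx; rewrite fineK// fin_numElt hNy.
have cF : convex_on C F.
  move=> x y t Cx Cy t01; have [gz gle] := convex_on_efun gNy cg Cx Cy t01.
  split; first exact: gz.
  rewrite /F /= (linear_on_segment (xs : {linear X -> R^o})).
  rewrite -[X in (_ + X + _)%R]/(t * x.2 + (1 - t) * y.2)%R.
  by move: gle => /=; lra.
have Pz0 : forall i, (q i (x0, fine (f x0) : R^o) <= a i)%R.
  by apply/epiP; rewrite /epi /= -finP.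
have F0 z : C z -> (forall i, (q i z <= a i)%R) -> (0 <= F z)%R.
  move=> Cz /epiP; rewrite /epi /= => fz.
  have dfz : edom f z.1 by rewrite /edom/=; apply: le_lt_trans fz (ltry _).
  have := le_trans (fenchel_young _ xs z.1) leM.
  rewrite -[(f \+ g) z.1]/(f z.1 + g z.1); move: fz.
  rewrite (finP f z.1)// (finP g z.1)// lee_fin => fz le.
  have : (xs z.1 - (fine (f z.1) + fine (g z.1)) <= M)%R by rewrite -lee_fin.
  by move: fz; rewrite /F => ? ?; lra.
have [psi [p [psip Fpsi]]] :=
  polyhedral_separation (z0 := (x0, fine (f x0) : R^o)) cF gx0 Pz0
    (nonsupport_point_cylinder gx0 (qri_nonsupport qx0)) F0.
(* [F + psi - p] is affine and bounded below on the vertical line through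
   [x0], on which its slope is [1 + psi (0, 1)]. *)
have psi01 : (1 + psi (0, 1) = 0)%R.
  apply: (@bounded_below_line _
    (p - dual_fst psi x0 - fine (g x0) + xs x0 - M)%R 0%R) => l.
  by have := Fpsi (x0, l) gx0; rewrite /F /= dual_prodE => ?; lra.
have {}psi01 : (psi (0, 1) = -1)%R by lra.
have psiE x l : (psi (x, l) = dual_fst psi x - l)%R.
  by rewrite dual_prodE psi01 mulrN1.
exists (dual_fst psi), (xs - dual_fst psi)%R.
split; last by rewrite addrC subrK.
have -> : M = (p + (M - p))%R by lra.
rewrite EFinD; apply: leeD; apply: fenchel_conj_le => // x l hl.
  by rewrite -psiE; apply: psip; apply/epiP.
have gx : edom g x by rewrite /edom/=; apply: le_lt_trans hl (ltry _).
have := Fpsi (x, 0%R) gx; rewrite dualD dualN psiE /F /=.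
by move: hl; rewrite finP// lee_fin => ? ?; lra.
Qed.

End FenchelDuality.

Local Open Scope ereal_scope.

Theorem theorem6p3 (R : realType) (X : tvsType R) (f g : X -> \bar R)
    (f_proper : proper_efun f) (f_convex : convex_efun f)
    (g_proper : proper_efun g) (g_convex : convex_efun g)
    (f_polyhedral : polyhedral f)
    (qualification : edom f `&` qri (edom g) !=set0) :
  (forall xs : tvs_dual X,
    fenchel_conj (f \+ g) xs =
    infimal_convolution (fenchel_conj f) (fenchel_conj g) xs) /\
  (forall xs : tvs_dual X, edom (fenchel_conj (f \+ g)) xs ->
    exists x1s x2s : tvs_dual X,
      fenchel_conj (f \+ g) xs = fenchel_conj f x1s + fenchel_conj g x2s /\
      xs = (x1s + x2s)%R).
Proof.
have [fNy _] := f_proper; have [gNy _] := g_proper.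
have attained xs : edom (fenchel_conj (f \+ g)) xs ->
    exists x1s x2s : tvs_dual X,
      fenchel_conj (f \+ g) xs = fenchel_conj f x1s + fenchel_conj g x2s /\
      xs = (x1s + x2s)%R.
  rewrite /edom /= => ltoo.
  have gtNoo : -oo < fenchel_conj (f \+ g) xs.
    have [x [fx [gx _]]] := qualification.
    apply: lt_le_trans (fenchel_young _ _ x).
    move: (fNy x) (gNy x) fx gx; rewrite /edom /=.
    case: (f x) => [l| |] //; case: (g x) => [m| |] // _ _ _ _; exact: ltNyr.
  have fin : fenchel_conj (f \+ g) xs \is a fin_num by rewrite fin_numElt gtNoo.
  have [|x1s [x2s [le xsE]]] := @fenchel_conj_add_attained _ _ f g xs
      (fine (fenchel_conj (f \+ g) xs)) f_proper g_proper g_convex f_polyhedral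
      qualification.
    by rewrite fineK.
  exists x1s, x2s; split=> //; apply/eqP; rewrite eq_le.
  by rewrite -{2}(fineK fin) le andbT xsE fenchel_conj_add_le.
split=> // xs; apply/eqP; rewrite eq_le; apply/andP; split.
  apply: le_ereal_inf_tmp => _ [[x1s x2s] /= <- <-].
  exact: fenchel_conj_add_le.
have [ltoo|] := ltP (fenchel_conj (f \+ g) xs) +oo; last first.
  by rewrite leye_eq => /eqP ->; exact: leey.
have [x1s [x2s [-> xsE]]] := attained _ ltoo.
by apply: ereal_inf_lbound; exists (x1s, x2s).
Qed.
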